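(* (M-INF) The following type is inhabited: $$\sum_{u:M}\ \prod_{z:M}\ \Bigl(z\in u\;\simeq\;\bigl(Z\,z\;+\;\sum_{y:M}(y\in u\;\wedge\;S\,y\,z)\bigr)\Bigr),$$ where, for $y,z:M$, $$S\,y\,z:=\prod_{x:M}\bigl(x\in z\;\simeq\;(x\in y\;+\;x=_M y)\bigr),\qquad Z\,z:=\prod_{x:M}\neg(x\in z).$$
   Context: The setting is Martin-Löf (homotopy/univalent) type theory with the Univalence Axiom (hence function extensionality); $A:\mathrm{Set}$ means ''$A$ is a type'' (not necessarily a 0-type), $A\simeq B$ is the type of equivalences as in the Homotopy Type Theory book, $+$ is the disjoint sum of types, $\wedge$ is the product type $\times$ (propositions-as-types), and $\neg A$ is $A\to 0$ with $0$ the empty type. $U:\mathrm{Set}$ is a univalent universe with decoding function $T:U\to\mathrm{Set}$; univalent means that for $a,b:U$ the canonical map $\mathrm{Id}_U\,a\,b\to (T\,a\simeq T\,b)$ is an equivalence. $U$ is assumed closed under $+$, $\Sigma$-, $\Pi$- and identity types, and to contain codes for the empty type $0$, the unit type $1$ and the type $\mathbb{N}$ of natural numbers. $M := W_{a:U}\,T\,a$ is the W-type with canonical elements $\sup\,a\,f$, where $a:U$ and $f:T\,a\to M$. The relation $=_M\,:M\to M\to\mathrm{Set}$ is defined by recursion: $$(\sup\,a\,f)=_M(\sup\,b\,g)\;:=\;\sum_{\alpha:T a\simeq T b}\ \prod_{x:T a}\ (f\,x)=_M\bigl(g\,(\alpha\,x)\bigr).$$ The relation $\in\,:M\to M\to\mathrm{Set}$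 is defined by $$x\in(\sup\,b\,g)\;:=\;\sum_{i:T b}\ x=_M(g\,i).$$ *)

(* Defs.v *)
(* Propositions-as-types throughout, over the bare Rocq prelude: every
   "proposition" of the theory is a Type, never a Prop. *)

Set Implicit Arguments.
Unset Strict Implicit.
Unset Printing Implicit Defensive.

(* The Martin-Löf identity type.  Stdlib's [eq] is deliberately not used: it
   lives in the impredicative sort Prop. *)
Inductive Id (A : Type) (a : A) : A -> Type :=
  | refl : Id a a.
Arguments refl {A a}.

Definition ap (A B : Type) (f : A -> B) (x y : A) (p : Id x y) :
    Id (f x) (f y) :=
  match p in Id _ y' return Id (f x) (f y') with refl => refl end.

(* Half-adjoint equivalences, the official definition of the HoTT book. *)
Record IsEquiv (A B : Type) (f : A -> B) : Type := MkIsEquiv {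
  inv : B -> A;
  inv_sect : forall x : A, Id (inv (f x)) x;
  inv_retr : forall y : B, Id (f (inv y)) y;
  inv_adj : forall x : A, Id (ap f (inv_sect x)) (inv_retr (f x))
}.

Record Equiv (A B : Type) : Type := MkEquiv {
  equiv_fun :> A -> B;
  equiv_isequiv : IsEquiv equiv_fun
}.

Notation "A <~> B" := (Equiv A B) (at level 85, no associativity) : type_scope.

Definition idEquiv (A : Type) : A <~> A :=
  MkEquiv (MkIsEquiv (f := fun x : A => x) (inv := fun x => x)
             (inv_sect := fun _ => refl) (inv_retr := fun _ => refl)
             (fun _ => refl)).

Definition happly (A : Type) (B : A -> Type) (f g : forall x, B x)
    (p : Id f g) : forall x, Id (f x) (g x) :=
  match p in Id _ g' return forall x, Id (f x) (g' x) with
  | refl => fun _ => refl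
  end.

(* The consequence, for arbitrary types, of the ambient Univalence Axiom. *)
Definition FunctionExtensionality : Type :=
  forall (A : Type) (B : A -> Type) (f g : forall x, B x),
    IsEquiv (@happly A B f g).

Definition idtoequiv (U : Type) (T : U -> Type) (a b : U) (p : Id a b) :
    T a <~> T b :=
  match p in Id _ b' return T a <~> T b' with refl => idEquiv (T a) end.

Definition IsUnivalent (U : Type) (T : U -> Type) : Type :=
  forall a b : U, IsEquiv (@idtoequiv U T a b).

(* Closure of a Tarski universe: each code decodes to the intended type up to
   equivalence, since a judgemental decoding cannot be assumed of a variable. *)
Record ClosedUniverse (U : Type) (T : U -> Type) : Type := MkClosedUniverse {
  sum_code : U -> U -> U;
  sum_decode : forall a b : U, T (sum_code a b) <~> (T a + T b);
  sigma_code : forall a : U, (T a -> U) -> U;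
  sigma_decode : forall (a : U) (b : T a -> U),
    T (sigma_code b) <~> { x : T a & T (b x) };
  pi_code : forall a : U, (T a -> U) -> U;
  pi_decode : forall (a : U) (b : T a -> U),
    T (pi_code b) <~> (forall x : T a, T (b x));
  id_code : forall a : U, T a -> T a -> U;
  id_decode : forall (a : U) (x y : T a), T (id_code x y) <~> Id x y;
  empty_code : U;
  empty_decode : T empty_code <~> Empty_set;
  unit_code : U;
  unit_decode : T unit_code <~> unit;
  nat_code : U;
  nat_decode : T nat_code <~> nat
}.

Inductive W (A : Type) (B : A -> Type) : Type :=
  | sup : forall a : A, (B a -> W B) -> W B.

Definition M (U : Type) (T : U -> Type) : Type := W T.

Fixpoint eqM (U : Type) (T : U -> Type) (x y : M T) {struct x} : Type :=
  match x, y with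
  | @sup _ _ a f, @sup _ _ b g =>
      { alpha : T a <~> T b & forall i : T a, eqM (f i) (g (alpha i)) }
  end.

Definition memM (U : Type) (T : U -> Type) (x y : M T) : Type :=
  match y with
  | @sup _ _ b g => { i : T b & eqM (T := T) x (g i) }
  end.

(* [succM y z] is S y z: z is y with one more element, y itself. *)
Definition succM (U : Type) (T : U -> Type) (y z : M T) : Type :=
  forall x : M T, memM x z <~> (memM x y + eqM x y).

(* [zeroM z] is Z z. *)
Definition zeroM (U : Type) (T : U -> Type) (z : M T) : Type :=
  forall x : M T, memM x z -> Empty_set.

(* Main.v *)
Require Import Defs.

Set Implicit Arguments.
Unset Strict Implicit.
Unset Printing Implicit Defensive.

(** The witness [u] is the multiset of numerals [n |-> numeral n], where
    [numeral 0] is the empty multiset and [numeral (S n)] adjoins [numeral n]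
    to itself.  Three identifications reduce the claim to arithmetic of
    sigma-types.

    By univalence of [T], [eqM x y] is the identity type [Id x y]
    ([eqM_equiv]); hence [memM z (sup b g)] is the fibre of [g] over [z]
    ([memM_equiv]).

    Multisets are extensional: [Id x y] is equivalent to the type of families
    of equivalences between the fibres of [x] and of [y] ([extensionality]).
    Indeed such a family is the same as an equivalence of the index types that
    commutes with the maps into [M T], and univalence turns the latter into an
    identification.

    Since the fibres of [emptyM] are empty and the fibre of [adjoinSelf y]
    over [x] is the fibre of [y] plus [Id y x], extensionality gives
    [zeroM z <~> Id emptyM z] and [succM y z <~> Id (adjoinSelf y) z].  Both
    sides of the theorem are then
    [Id emptyM z + { n : nat & Id (adjoinSelf (numeral n)) z }]: on the left
    one splits off the index [0], on the right one contracts the element [y]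
    onto the numeral that it is equal to.  It is nowhere needed that distinct
    numerals are different. *)

(** * Paths and half-adjoint equivalences *)

Definition sym (A : Type) (x y : A) (p : Id x y) : Id y x :=
  match p in Id _ y' return Id y' x with refl => refl end.

Definition concat (A : Type) (x y z : A) (p : Id x y) (q : Id y z) : Id x z :=
  match q in Id _ z' return Id x z' with refl => p end.

Definition transport (A : Type) (P : A -> Type) (x y : A) (p : Id x y) :
    P x -> P y :=
  match p in Id _ y' return P x -> P y' with refl => fun u => u end.

Lemma concat_refl_l (A : Type) (x y : A) (p : Id x y) : Id (concat refl p) p.
Proof. destruct p; exact refl. Defined.

Lemma concat_cancel_r (A : Type) (x y z : A) (p q : Id x y) (r : Id y z) :
  Id (concat p r) (concat q r) -> Id p q.
Proof. destruct r; exact (fun h => h). Qed.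

Lemma concat_sym_l (A : Type) (x y z : A) (p : Id x y) (q : Id x z)
    (r : Id y z) :
  Id (concat p r) q -> Id r (concat (sym p) q).
Proof.
  intros h; destruct h; destruct r; destruct p; exact refl.
Qed.

Lemma ap_compose (A B C : Type) (f : A -> B) (g : B -> C) (x y : A)
    (p : Id x y) :
  Id (ap g (ap f p)) (ap (fun a => g (f a)) p).
Proof. destruct p; exact refl. Qed.

(** Naturality of a homotopy to the identity. *)
Lemma homotopy_natural (A : Type) (k : A -> A) (h : forall x, Id (k x) x)
    (x y : A) (p : Id x y) :
  Id (concat (ap k p) (h y)) (concat (h x) p).
Proof. destruct p; apply concat_refl_l. Qed.

Lemma homotopy_natural_self (A : Type) (k : A -> A)
    (h : forall x, Id (k x) x) (x : A) :
  Id (ap k (h x)) (h (k x)).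
Proof.
  apply (@concat_cancel_r _ _ _ _ _ _ (h x)). apply homotopy_natural.
Qed.

Section Adjointify.
Context (A B : Type) (f : A -> B) (g : B -> A)
  (s : forall x, Id (g (f x)) x) (r : forall y, Id (f (g y)) y).

Definition adjointify_retr (y : B) : Id (f (g y)) y :=
  concat (sym (r (f (g y)))) (concat (ap f (s (g y))) (r y)).

Lemma adjointify_adj (x : A) : Id (ap f (s x)) (adjointify_retr (f x)).
Proof.
  apply concat_sym_l, sym.
  apply (transport (P := fun p => Id (concat (ap f p) (r (f x))) _)
           (homotopy_natural_self s x)).
  apply (transport (P := fun p => Id (concat p _) _)
           (sym (ap_compose (fun a => g (f a)) f (s x)))).
  apply (transport (P := fun p => Id (concat p _) _)
           (ap_compose f (fun b => f (g b)) (s x))).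
  exact (homotopy_natural r (ap f (s x))).
Qed.

(** Every quasi-inverse extends to a half-adjoint equivalence; only the
    homotopy [f (g y) = y] is changed. *)
Definition adjointify : A <~> B :=
  MkEquiv (MkIsEquiv adjointify_adj).

End Adjointify.

Definition equiv_sym (A B : Type) (e : A <~> B) : B <~> A :=
  adjointify (inv_retr (equiv_isequiv e)) (inv_sect (equiv_isequiv e)).

Definition equiv_trans (A B C : Type) (e : A <~> B) (e' : B <~> C) : A <~> C.
Proof.
  refine (adjointify (f := fun x => e' (e x))
            (g := fun z => equiv_sym e (equiv_sym e' z)) _ _).
  - intros x.
    exact (concat (ap (equiv_sym e) (inv_sect (equiv_isequiv e') (e x)))
             (inv_sect (equiv_isequiv e) x)).
  - intros z.
    exact (concat (ap e' (inv_retr (equiv_isequiv e) (equiv_sym e' z)))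
             (inv_retr (equiv_isequiv e') z)).
Defined.

Definition equiv_path_sym (A : Type) (x y : A) : Id x y <~> Id y x.
Proof.
  refine (adjointify (f := @sym A x y) (g := @sym A y x) _ _);
    intros p; destruct p; exact refl.
Defined.

(** * Congruences of equivalences for sums and sigma-types *)

Lemma equiv_sum (A A' B B' : Type) (e : A <~> A') (e' : B <~> B') :
  (A + B) <~> (A' + B').
Proof.
  refine (adjointify
    (f := fun s => match s with inl a => inl (e a) | inr b => inr (e' b) end)
    (g := fun s => match s with
                   | inl a => inl (equiv_sym e a)
                   | inr b => inr (equiv_sym e' b)
                   end) _ _).
  - intros [a|b]; apply ap; apply inv_sect.
  - intros [a|b]; apply ap; [exact (inv_retr (equiv_isequiv e) a)
                            |exact (inv_retr (equiv_isequiv e') b)].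
Qed.

Lemma equiv_prod (A A' B B' : Type) (e : A <~> A') (e' : B <~> B') :
  (A * B)%type <~> (A' * B')%type.
Proof.
  refine (adjointify
    (f := fun s => match s with (a, b) => (e a, e' b) end)
    (g := fun s => match s with (a, b) => (equiv_sym e a, equiv_sym e' b) end)
    _ _); intros [a b]; cbn.
  - exact (concat (ap (fun c => (c, _)) (inv_sect (equiv_isequiv e) a))
             (ap (pair a) (inv_sect (equiv_isequiv e') b))).
  - exact (concat (ap (fun c => (c, _)) (inv_retr (equiv_isequiv e) a))
             (ap (pair a) (inv_retr (equiv_isequiv e') b))).
Qed.

Lemma equiv_sigma (A : Type) (P Q : A -> Type) (e : forall x, P x <~> Q x) :
  { x : A & P x } <~> { x : A & Q x }.
Proof.
  refine (adjointify
    (f := fun w => match w with existT _ x p => existT Q x (e x p) end)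
    (g := fun w => match w with existT _ x q => existT P x (equiv_sym (e x) q)
                   end) _ _).
  - intros [x p]; exact (ap (existT P x) (inv_sect (equiv_isequiv (e x)) p)).
  - intros [x q]; exact (ap (existT Q x) (inv_retr (equiv_isequiv (e x)) q)).
Qed.

Lemma path_sigma_transport (B : Type) (Q : B -> Type) (b b' : B)
    (p : Id b b') (q : Q b') :
  Id (existT Q b (transport (P := Q) (sym p) q)) (existT Q b' q).
Proof. destruct p; exact refl. Qed.

(** Reindexing a sigma-type along an equivalence of the base. *)
Lemma equiv_sigma_base (A B : Type) (e : A <~> B) (Q : B -> Type) :
  { x : A & Q (e x) } <~> { y : B & Q y }.
Proof.
  refine (adjointify
    (f := fun w => match w with existT _ x q => existT Q (e x) q end)
    (g := fun w => match w with existT _ y q =>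
             existT (fun x => Q (e x)) (inv (equiv_isequiv e) y)
               (transport (P := Q) (sym (inv_retr (equiv_isequiv e) y)) q) end)
    _ _).
  - intros [x q].
    destruct (inv_adj (equiv_isequiv e) x).
    generalize (inv_sect (equiv_isequiv e) x).
    generalize (inv (equiv_isequiv e) (e x)).
    intros x' p; destruct p; exact refl.
  - intros [y q]; apply path_sigma_transport.
Qed.

Lemma equiv_sigma_sum (A B : Type) (Q : A + B -> Type) :
  { s : A + B & Q s } <~> ({ a : A & Q (inl a) } + { b : B & Q (inr b) }).
Proof.
  refine (adjointify
    (f := fun w : { s : A + B & Q s } =>
            match w with
            | existT _ (inl a) q => inl (existT (fun a => Q (inl a)) a q)
            | existT _ (inr b) q => inr (existT (fun b => Q (inr b)) b q)
            end)
    (g := fun w => match w with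
                   | inl (existT _ a q) => existT Q (inl a) q
                   | inr (existT _ b q) => existT Q (inr b) q
                   end) _ _).
  - intros [[a|b] q]; exact refl.
  - intros [[a q]|[b q]]; exact refl.
Qed.

Lemma equiv_sigma_unit (P : Type) : { _ : unit & P } <~> P.
Proof.
  refine (adjointify (f := fun w => match w with existT _ _ p => p end)
    (g := fun p => existT (fun _ => P) tt p) _ _).
  - intros [[] p]; exact refl.
  - intros p; exact refl.
Qed.

Lemma equiv_sigma_nat (Q : nat -> Type) :
  { n : nat & Q n } <~> (Q 0 + { n : nat & Q (S n) }).
Proof.
  refine (adjointify
    (f := fun w : { n : nat & Q n } =>
            match w with
            | existT _ 0 q => inl q
            | existT _ (S n) q => inr (existT (fun n => Q (S n)) n q)
            end)
    (g := fun w => match w with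
                   | inl q => existT Q 0 q
                   | inr (existT _ n q) => existT Q (S n) q
                   end) _ _).
  - intros [[|n] q]; exact refl.
  - intros [q|[n q]]; exact refl.
Qed.

(** Contracting the variable [y] onto the point [h n] that it is equal to. *)
Lemma equiv_sigma_image (N X : Type) (h : N -> X) (Q : X -> Type) :
  { y : X & ({ n : N & Id (h n) y } * Q y)%type } <~> { n : N & Q (h n) }.
Proof.
  refine (adjointify
    (f := fun w : { y : X & ({ n : N & Id (h n) y } * Q y)%type } =>
            match w with
            | existT _ y (existT _ n p, q) =>
                existT (fun n => Q (h n)) n (transport (P := Q) (sym p) q)
            end)
    (g := fun w =>
            match w with
            | existT _ n q =>
                existT (fun y => ({ n : N & Id (h n) y } * Q y)%type) (h n)
                  (existT (fun n' => Id (h n') (h n)) n refl, q)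
            end) _ _).
  - intros [y [[n p] q]]; destruct p; exact refl.
  - intros [n q]; exact refl.
Qed.

(** * Function extensionality and uniqueness of inverses *)

Definition funext_path (funext : FunctionExtensionality) (A : Type)
    (B : A -> Type) (f g : forall x, B x) (h : forall x, Id (f x) (g x)) :
    Id f g :=
  inv (funext A B f g) h.

Lemma equiv_pi (funext : FunctionExtensionality) (A : Type)
    (P Q : A -> Type) (e : forall x, P x <~> Q x) :
  (forall x, P x) <~> (forall x, Q x).
Proof.
  refine (adjointify (f := fun (k : forall x, P x) x => e x (k x))
            (g := fun (k : forall x, Q x) x => equiv_sym (e x) (k x)) _ _);
    intros k; apply (funext_path funext); intros x.
  - exact (inv_sect (equiv_isequiv (e x)) (k x)).
  - exact (inv_retr (equiv_isequiv (e x)) (k x)).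
Qed.

(** Mere propositions: types with at most one element up to identity. *)
Definition IsProp (A : Type) : Type := forall x y : A, Id x y.

Lemma isprop_path (A : Type) (h : IsProp A) (x y : A) : IsProp (Id x y).
Proof.
  assert (c : forall p : Id x y, Id p (concat (sym (h x x)) (h x y))).
  { intros p; destruct p; apply concat_sym_l; exact refl. }
  intros p q; exact (concat (c p) (sym (c q))).
Qed.

(** The fibre of [f] over [y]. *)
Definition Fib (A B : Type) (f : A -> B) (y : B) : Type :=
  { x : A & Id (f x) y }.

(** A path in the fibre of [f] over [f x] ending at [(x, refl)] amounts to a
    pair [p : Id a x], [Id (ap f p) r]; the next lemmas give both directions
    and one round trip. *)
Section FibrePaths.
Context (A B : Type) (f : A -> B).

Definition fib_path (a x : A) (r : Id (f a) (f x))
    (w : { p : Id a x & Id (ap f p) r }) :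
    Id (existT (fun a => Id (f a) (f x)) a r) (existT _ x refl).
Proof.
  destruct w as [p q]; destruct q; destruct p; exact refl.
Defined.

Lemma fib_path_adj (y : B) (w w' : Fib f y) (d : Id w w') :
  Id (concat (ap f (ap (@projT1 _ _) d)) (projT2 w')) (projT2 w).
Proof. destruct d; apply concat_refl_l. Defined.

Definition fib_unpath (a x : A) (r : Id (f a) (f x))
    (d : Id (existT (fun a => Id (f a) (f x)) a r) (existT _ x refl)) :
    { p : Id a x & Id (ap f p) r } :=
  existT (fun p : Id a x => Id (ap f p) r)
    (ap (@projT1 _ _) d) (fib_path_adj d).

Lemma fib_unpath_path (a x : A) (r : Id (f a) (f x))
    (w : { p : Id a x & Id (ap f p) r }) :
  Id (fib_unpath (fib_path w)) w.
Proof.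
  destruct w as [p q]; destruct q; destruct p; exact refl.
Qed.

Lemma isprop_fib (e : IsEquiv f) (y : B) : IsProp (Fib f y).
Proof.
  assert (c : forall w : Fib f y,
             Id (existT (fun a => Id (f a) y) (inv e y) (inv_retr e y)) w).
  { intros [x q]; destruct q.
    apply fib_path; exists (inv_sect e x); apply inv_adj. }
  intros w w'; exact (concat (sym (c w)) (c w')).
Qed.

(** Half-adjoint structure in terms of fibres: a section [c] of all fibres
    that is canonical at the points [f x]. *)
Definition FibSection : Type :=
  { c : forall y, Fib f y &
    forall x, Id (c (f x)) (existT (fun a => Id (f a) (f x)) x refl) }.

Lemma isprop_fibsection (funext : FunctionExtensionality) (e : IsEquiv f) :
  IsProp FibSection.
Proof.
  intros [c d] [c' d'].
  assert (p : Id c c').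
  { apply (funext_path funext); intros y; apply (isprop_fib e). }
  destruct p. apply ap, (funext_path funext); intros x.
  apply isprop_path, (isprop_fib e).
Qed.

(** Half-adjoint structure with the section homotopy and the adjunction law
    paired pointwise, so that function extensionality can vary both at once. *)
Definition isequiv_build (g : B -> A) (r : forall y, Id (f (g y)) y)
    (w : forall x, { p : Id (g (f x)) x & Id (ap f p) (r (f x)) }) :
    IsEquiv f :=
  MkIsEquiv (fun x => projT2 (w x)).

Definition isequiv_of_fibsection (t : FibSection) : IsEquiv f.
Proof.
  refine (isequiv_build (g := fun y => projT1 (projT1 t y))
            (r := fun y => projT2 (projT1 t y)) _).
  intros x; apply fib_unpath.
  refine (concat _ (projT2 t x)).
  destruct (projT1 t (f x)); exact refl.
Defined.

(** This is why being an equivalence is a mere proposition: [IsEquiv f] is an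
    image of [FibSection], which is one as soon as [f] is an equivalence. *)
Lemma isequiv_of_fibsection_surj (funext : FunctionExtensionality)
    (e : IsEquiv f) :
  { t : FibSection & Id (isequiv_of_fibsection t) e }.
Proof.
  destruct e as [g s r a].
  pose (w := fun x =>
    existT (fun p : Id (g (f x)) x => Id (ap f p) (r (f x))) (s x) (a x)).
  exists (existT
    (fun c : forall y, Fib f y =>
       forall x, Id (c (f x)) (existT (fun a => Id (f a) (f x)) x refl))
    (fun y => existT (fun a => Id (f a) y) (g y) (r y))
    (fun x => fib_path (w x))).
  change (MkIsEquiv a) with (isequiv_build w).
  apply (ap (@isequiv_build g r)), (funext_path funext); intros x; cbn.
  refine (concat _ (fib_unpath_path (w x))).
  apply ap, concat_refl_l.
Qed.

Lemma isprop_isequiv (funext : FunctionExtensionality) : IsProp (IsEquiv f).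
Proof.
  intros e e'.
  destruct (isequiv_of_fibsection_surj funext e) as [t p].
  destruct (isequiv_of_fibsection_surj funext e') as [t' p'].
  refine (concat (sym p) (concat (ap _ _) p')).
  apply (isprop_fibsection funext e).
Qed.

End FibrePaths.

Lemma equiv_eq (funext : FunctionExtensionality) (A B : Type) (e e' : A <~> B)
    (h : forall x, Id (e x) (e' x)) : Id e e'.
Proof.
  destruct e as [f ef], e' as [f' ef'].
  assert (p : Id f f') by exact (funext_path funext h).
  clear h; destruct p.
  apply ap, (isprop_isequiv funext).
Qed.

Lemma equiv_equiv (funext : FunctionExtensionality) (A A' B B' : Type)
    (e : A <~> A') (e' : B <~> B') :
  (A <~> B) <~> (A' <~> B').
Proof.
  refine (adjointify
    (f := fun k => equiv_trans (equiv_sym e) (equiv_trans k e'))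
    (g := fun k => equiv_trans e (equiv_trans k (equiv_sym e'))) _ _);
    intros k; apply (equiv_eq funext); intros x; cbn.
  - refine (concat (inv_sect (equiv_isequiv e') _) (ap k _)).
    apply inv_sect.
  - refine (concat (inv_retr (equiv_isequiv e') _) (ap k _)).
    apply inv_retr.
Qed.

(** [A] is empty exactly if its copy [A'] is equivalent to the empty type [B],
    and both statements are mere propositions. *)
Lemma equiv_not (funext : FunctionExtensionality) (A A' B : Type)
    (e : A <~> A') (n : B -> Empty_set) :
  (A -> Empty_set) <~> (A' <~> B).
Proof.
  assert (g : (A -> Empty_set) -> (A' <~> B)).
  { intros h.
    refine (adjointify
      (f := fun a => match h (equiv_sym e a) return B with end)
      (g := fun b => match n b return A' with end) _ _).
    - intros a; destruct (h (equiv_sym e a)).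
    - intros b; destruct (n b). }
  refine (adjointify (f := g) (g := fun k a => n (k (e a))) _ _).
  - intros h; apply (funext_path funext); intros a; destruct (h a).
  - intros k; apply (equiv_eq funext); intros a; destruct (n (k a)).
Qed.

(** A reflexive family whose total space is contracted onto the diagonal point
    is equivalent to the identity type. *)
Lemma equiv_id_of_contr (A : Type) (x : A) (R : A -> Type) (r : R x)
    (c : forall w : { y : A & R y }, Id (existT R x r) w) (y : A) :
  Id x y <~> R y.
Proof.
  pose (s := fun y (q : R y) => ap (@projT1 _ _) (c (existT R y q))).
  (* Corrected by [s x r], the candidate inverse sends [r] to [refl]. *)
  pose (t := fun y (q : R y) => concat (sym (s x r)) (s y q)).
  assert (t0 : Id (t x r) refl).
  { unfold t; destruct (s x r); exact refl. }
  refine (adjointify (f := fun p => transport (P := R) p r) (g := t y) _ _).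
  - intros p; destruct p; exact t0.
  - intros q.
    assert (h : forall w : { y : A & R y },
               Id (existT R x r) w ->
               Id (transport (P := R) (t (projT1 w) (projT2 w)) r) (projT2 w)).
    { intros w d; destruct d; cbn.
      exact (ap (fun p => transport (P := R) p r) t0). }
    exact (h _ (c (existT R y q))).
Qed.

(** * Identity and membership of multisets *)

Section Multisets.
Context (funext : FunctionExtensionality) (U : Type) (T : U -> Type)
  (univ : IsUnivalent T).

(** The diagonal of [eqM], given by identity equivalences throughout. *)
Fixpoint eqM_refl (x : M T) : eqM x x :=
  match x return eqM x x with
  | @sup _ _ a f =>
      existT (fun e : T a <~> T a => forall i, eqM (f i) (f (e i)))
        (idEquiv (T a)) (fun i => eqM_refl (f i))
  end.

(** The multisets equal to [x] in the sense of [eqM] form a contractible type.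
    Univalence reduces to the case that [y] has the index type of [x] and the
    two families are compared index by index. *)
Lemma eqM_contr (x : M T) (w : { y : M T & eqM x y }) :
  Id (existT (eqM x) x (eqM_refl x)) w.
Proof.
  revert w; induction x as [a f IH]; intros [[b g] [e h]].
  revert h; destruct (inv_retr (univ a b) e).
  generalize (inv (univ a b) e); intros p; destruct p; cbn; intros h.
  (* A point of the total space of [eqM (f i)] for every index [i] gives one of
     the total space of [eqM (sup f)]. *)
  pose (build := fun k : forall i : T a, { y : M T & eqM (f i) y } =>
    existT (eqM (sup f)) (sup (fun i => projT1 (k i)))
      (existT (fun e : T a <~> T a =>
                 forall i, eqM (f i) (projT1 (k (e i)))) (idEquiv _)
         (fun i => projT2 (k i)))).
  apply (ap build
    (x := fun i => existT (eqM (f i)) (f i) (eqM_refl (f i)))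
    (y := fun i => existT (eqM (f i)) (g i) (h i))).
  apply (funext_path funext); intros i; apply IH.
Qed.

Lemma eqM_equiv (x y : M T) : Id x y <~> eqM x y.
Proof. exact (equiv_id_of_contr (@eqM_contr x) y). Qed.

(** Membership as the fibre of the family of elements. *)
Definition FibM (z x : M T) : Type :=
  match x with sup f => Fib f z end.

Lemma memM_equiv (z x : M T) : memM z x <~> FibM z x.
Proof.
  destruct x as [a f]; apply equiv_sigma; intros i.
  exact (equiv_trans (equiv_sym (eqM_equiv z (f i))) (equiv_path_sym _ _)).
Qed.

(** * Extensionality of multisets *)

(** An equivalence of all fibres induces an equivalence of the domains. *)
Definition domain_equiv (A B X : Type) (f : A -> X) (g : B -> X)
    (k : forall z, Fib f z <~> Fib g z) : A <~> B.
Proof.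
  refine (adjointify
    (f := fun i => projT1 (k (f i) (existT (fun j => Id (f j) _) i refl)))
    (g := fun j => projT1 (equiv_sym (k (g j))
                             (existT (fun j => Id (g j) _) j refl))) _ _).
  - intros i.
    refine (concat _ (ap (@projT1 _ _) (inv_sect (equiv_isequiv (k (f i)))
             (existT (fun j => Id (f j) (f i)) i refl)))).
    generalize (k (f i) (existT (fun j => Id (f j) (f i)) i refl)).
    generalize (f i); intros z [j q]; destruct q; exact refl.
  - intros j.
    refine (concat _ (ap (@projT1 _ _) (inv_retr (equiv_isequiv (k (g j)))
             (existT (fun i => Id (g i) (g j)) j refl)))).
    cbn.
    generalize (inv (equiv_isequiv (k (g j)))
                  (existT (fun i => Id (g i) (g j)) j refl)).
    generalize (g j); intros z [i q]; destruct q; exact refl.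
Defined.

(** A choice of points [c i] in the fibres of [g] over [f i], lying at the
    index [i], is nothing but an identification of [f] with [g]. *)
Lemma fib_choice_contr (A X : Type) (f g : A -> X)
    (c : forall i, Fib g (f i)) (h : forall i, Id i (projT1 (c i))) :
  Id (existT (fun g : A -> X => forall i, Fib g (f i)) f
        (fun i => existT (fun j => Id (f j) (f i)) i refl))
     (existT _ g c).
Proof.
  assert (w : forall i, { q : Id (g i) (f i) &
             Id (existT (fun j => Id (g j) (f i)) i q) (c i) }).
  { intros i; generalize (h i); destruct (c i) as [j q]; cbn.
    intros p; destruct p; exists q; exact refl. }
  pose (q := fun i => projT1 (w i)).
  assert (p : Id (fun i => existT (fun j => Id (g j) (f i)) i (q i)) c)
    by exact (funext_path funext (fun i => projT2 (w i))).
  clearbody q; clear w h; destruct p.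
  assert (w : { p : Id g f & Id (happly p) q })
    by (exists (funext_path funext q); apply inv_retr).
  destruct w as [p e]; destruct e; destruct p; exact refl.
Qed.

(** The diagonal of the relation of having equivalent fibres. *)
Definition IdEquivs (x : M T) : forall z, FibM z x <~> FibM z x :=
  fun z => idEquiv (FibM z x).

(** The multisets [y] with the same fibres as [x] form a contractible type.
    Univalence, applied to [domain_equiv], reduces to equal index types and to
    fibre equivalences that keep the index; these are determined by their
    values at the points [(i, refl)], so [fib_choice_contr] applies. *)
Lemma extensionality_contr (x : M T)
    (w : { y : M T & forall z, FibM z x <~> FibM z y }) :
  Id (existT (fun y => forall z, FibM z x <~> FibM z y) x (IdEquivs x)) w.
Proof.
  destruct x as [a f], w as [[b g] k]; cbn in k.
  pose proof (happly (ap (@equiv_fun _ _)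
    (inv_retr (univ a b) (domain_equiv k)))) as h; cbn in h; revert h.
  generalize (inv (univ a b) (domain_equiv k)); intros p.
  destruct p; cbn; intros h.
  (* A choice of points in the fibres of [g] over all [f i] extends to all
     fibres of [f] by path induction. *)
  pose (ext := fun w : { g : T a -> M T & forall i, Fib g (f i) } =>
    existT (fun g : T a -> M T => forall z, Fib f z -> Fib g z) (projT1 w)
      (fun z (v : Fib f z) =>
         match v with existT _ i q => transport (P := Fib (projT1 w)) q
                                        (projT2 w i) end)).
  pose proof (ap ext (fib_choice_contr
    (c := fun i => k (f i) (existT (fun j => Id (f j) (f i)) i refl)) h)) as d.
  (* Path induction on the extended identification leaves the case [g = f] with
     fibre maps that are pointwise the identity. *)
  assert (main : forall v : { g : T a -> M T &
                                forall z, Fib f z -> Fib g z },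
    Id (ext (existT _ f (fun i => existT (fun j => Id (f j) (f i)) i refl))) v
    -> forall e : (forall z, Fib f z <~> Fib (projT1 v) z),
       (forall z u, Id (projT2 v z u) (e z u)) ->
       Id (existT (fun y => forall z, FibM z (sup f) <~> FibM z y) (sup f)
             (IdEquivs (sup f)))
          (existT (fun y => forall z, FibM z (sup f) <~> FibM z y)
             (sup (projT1 v)) e)).
  { intros v d' e; destruct d'; cbn; intros he.
    apply ap, (funext_path funext); intros z; apply (equiv_eq funext).
    intros u; refine (concat _ (he z u)).
    destruct u as [i q]; destruct q; exact refl. }
  apply (main _ d k).
  intros z [i q]; destruct q; exact refl.
Qed.

Lemma extensionality (x y : M T) :
  Id x y <~> (forall z, FibM z x <~> FibM z y).
Proof. exact (equiv_id_of_contr (@extensionality_contr x) y). Qed.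

(** * Zero, successor and the numerals *)

Context (closed : ClosedUniverse T).

(** The empty multiset. *)
Definition emptyM : M T :=
  sup (a := empty_code closed)
    (fun i => match empty_decode closed i return M T with end).

(** The multiset [y] with the further element [y]. *)
Definition adjoinSelf (y : M T) : M T :=
  match y with
  | @sup _ _ b g =>
      sup (a := sum_code closed b (unit_code closed))
        (fun i => match sum_decode closed b (unit_code closed) i with
                  | inl j => g j
                  | inr _ => y
                  end)
  end.

(** The von Neumann numerals as multisets. *)
Fixpoint numeral (n : nat) : M T :=
  match n with 0 => emptyM | S n => adjoinSelf (numeral n) end.

(** The multiset of all numerals. *)
Definition omegaM : M T :=
  sup (a := nat_code closed) (fun i => numeral (nat_decode closed i)).

Lemma fib_emptyM (z : M T) : FibM z emptyM -> Empty_set.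
Proof. intros [i _]; exact (empty_decode closed i). Qed.

Lemma fib_adjoinSelf (x y : M T) :
  FibM x (adjoinSelf y) <~> (FibM x y + Id y x).
Proof.
  destruct y as [b g].
  refine (equiv_trans (equiv_sigma_base _
    (fun s => Id (match s with inl j => g j | inr _ => sup g end) x)) _).
  refine (equiv_trans (equiv_sigma_sum _) _).
  apply equiv_sum; [exact (idEquiv _)|].
  exact (equiv_trans
    (equiv_sigma_base (unit_decode closed) (fun _ => Id (sup g) x))
    (equiv_sigma_unit _)).
Qed.

Lemma zeroM_equiv (z : M T) : zeroM z <~> Id emptyM z.
Proof.
  refine (equiv_trans _ (equiv_path_sym z emptyM)).
  refine (equiv_trans _ (equiv_sym (extensionality z emptyM))).
  apply (equiv_pi funext); intros x.
  exact (equiv_not funext (memM_equiv x z) (@fib_emptyM x)).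
Qed.

Lemma succM_equiv (y z : M T) : succM y z <~> Id (adjoinSelf y) z.
Proof.
  refine (equiv_trans _ (equiv_path_sym z (adjoinSelf y))).
  refine (equiv_trans _ (equiv_sym (extensionality z (adjoinSelf y)))).
  apply (equiv_pi funext); intros x.
  apply (equiv_equiv funext (memM_equiv x z)).
  refine (equiv_trans _ (equiv_sym (fib_adjoinSelf x y))).
  apply equiv_sum; [exact (memM_equiv x y)|].
  exact (equiv_trans (equiv_sym (eqM_equiv x y)) (equiv_path_sym x y)).
Qed.

Lemma mem_omegaM_equiv (z : M T) :
  memM z omegaM <~> { n : nat & Id (numeral n) z }.
Proof.
  exact (equiv_trans (memM_equiv z omegaM)
    (equiv_sigma_base (nat_decode closed) (fun n => Id (numeral n) z))).
Qed.

Lemma omegaM_infinite (z : M T) :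
  memM z omegaM <~>
  (zeroM z + { y : M T & (memM y omegaM * succM y z)%type }).
Proof.
  refine (equiv_trans (mem_omegaM_equiv z) _).
  refine (equiv_trans (equiv_sigma_nat _) _).
  apply equiv_sum; [exact (equiv_sym (zeroM_equiv z))|].
  apply equiv_sym.
  refine (equiv_trans _
    (equiv_sigma_image numeral (fun y => Id (adjoinSelf y) z))).
  apply equiv_sigma; intros y.
  exact (equiv_prod (mem_omegaM_equiv y) (succM_equiv y z)).
Qed.

End Multisets.

Theorem proposition4
  (funext : FunctionExtensionality)
  (U : Type) (T : U -> Type)
  (univ : IsUnivalent T)
  (closed : ClosedUniverse T) :
  { u : M T &
    forall z : M T,
      memM z u <~> (zeroM z + { y : M T & (memM y u * succM y z)%type }) }.
Proof.
  exact (existT _ (omegaM closed) (omegaM_infinite funext univ closed)).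
Qed.
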